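(* For every even positive integer $n$, every irreducible factor in $\mathbb{Z}[x]$ of the Lucas polynomial $L_n(x)$ is monogenic.
   Context: The Lucas polynomials $L_n(x)\in\mathbb{Z}[x]$ are defined by $L_0(x)=2$, $L_1(x)=x$, and $L_n(x)=xL_{n-1}(x)+L_{n-2}(x)$ for $n\ge 2$. A non-zero irreducible polynomial $f(x)\in\mathbb{Z}[x]$ is called monogenic if there exists a root $\alpha$ of $f(x)$ such that $\mathbb{Z}[\alpha]$ is exactly the ring of integers of the field $\mathbb{Q}(\alpha)$. *)

(* Defs.v *)
From mathcomp Require Import all_boot all_order all_algebra all_field.

Set Implicit Arguments.
Unset Strict Implicit.
Unset Printing Implicit Defensive.

Import Order.TTheory GRing.Theory Num.Theory.
Local Open Scope ring_scope.

Fixpoint lucas (n : nat) : {poly int} :=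
  match n with
  | 0 => 2
  | m.+1 => match m with
            | 0 => 'X
            | k.+1 => 'X * lucas m + lucas k
            end
  end.

(* Irreducible elements of the ring Z[x]; [irreducible_poly] is not used because
   over int it ignores constant factors (e.g. it holds of 2 *: 'X). *)
Definition irreducibleZ (f : {poly int}) : Prop :=
  [/\ f != 0, f \isn't a GRing.unit
    & forall g h : {poly int}, f = g * h ->
        g \is a GRing.unit \/ h \is a GRing.unit].

Definition in_Zadjoin (a z : algC) : Prop :=
  exists p : {poly int}, z = (map_poly intr p).[a].

Definition in_Qadjoin (a z : algC) : Prop :=
  exists p q : {poly rat},
    (map_poly ratr q).[a] != 0 /\
    z = (map_poly ratr p).[a] / (map_poly ratr q).[a].

Definition in_ring_of_integers (a z : algC) : Prop :=
  in_Qadjoin a z /\ z \in Aint.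

(* Every complex root of an integer polynomial is in algC, so no generality is
   lost by taking the root there. *)
Definition monogenic (f : {poly int}) : Prop :=
  irreducibleZ f /\
  exists2 a : algC, root (map_poly intr f) a
    & forall z : algC, in_Zadjoin a z <-> in_ring_of_integers a z.

(* Main.v *)
Require Import Defs.
From mathcomp Require Import all_boot all_order all_algebra all_field.
From mathcomp Require Import cyclic ring zify.

Set Implicit Arguments.
Unset Strict Implicit.
Unset Printing Implicit Defensive.

Import Order.TTheory GRing.Theory Num.Theory.
Local Open Scope ring_scope.

(** The identity L_n(y - 1/y) = y ^ n + (- 1/y) ^ n (lemma lucas_eval) shows
    that, for n even and positive, the roots of L_n are the numbers a = y - 1/y
    with y ^ (2 n) = -1. Such a y is a root of unity whose order N divides 4 n
    and does not divide 2 n, so that 8 divides N.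

    The field Q(a) is fixed by the automorphism y |-> - 1/y of Q(y). An integer
    of Q(a) is an integer of Q(y), hence an element of Z[y]. Since
    y ^ 2 = a y + 1, it can be written w1 + w2 y with w1 and w2 in Z[a], and
    invariance under the automorphism forces w2 = 0 (lemma sub_inv_integers).
    So the integers of Q(a) are the elements of Z[a].

    What remains is that Z[y] contains all the integers of Q(y), for any root of
    unity y (lemma cyclotomic_integers). It is enough to show, for every prime
    p, that an algebraic integer z with p z in Z[y] is in Z[y]. When p does not
    divide the order of y, an iterate of Frobenius is the identity on Z[y] / p,
    so that this ring has no nilpotents; as a = p z satisfies a ^ q in p Z[y]
    for q large, a is in p Z[y] (lemma Zadjoin_maximal_unramified). When p
    divides the order, y is congruent, modulo the uniformizer pi = 1 - h of a
    subring Z[h] where p is totally ramified, to a root of unity x of order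
    prime to p. The unramified case for Z[x] then allows p z to be approximated
    pi-adically by elements of p Z[y], up to the power of pi which is p times a
    unit (lemma Zadjoin_maximal). *)

(** * The ring Z[a] *)

Lemma Zadjoin_int (a : algC) (c : int) : in_Zadjoin a c%:~R.
Proof. by exists c%:P; rewrite map_polyC hornerC. Qed.

Lemma Zadjoin_nat (a : algC) (n : nat) : in_Zadjoin a n%:R.
Proof. exact: (Zadjoin_int a n). Qed.

Lemma Zadjoin1 (a : algC) : in_Zadjoin a 1.
Proof. exact: (Zadjoin_int a 1). Qed.

Lemma Zadjoin_gen (a : algC) : in_Zadjoin a a.
Proof. by exists 'X; rewrite map_polyX hornerX. Qed.

Lemma ZadjoinD (a x y : algC) :
  in_Zadjoin a x -> in_Zadjoin a y -> in_Zadjoin a (x + y).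
Proof. by case=> p -> [q ->]; exists (p + q); rewrite rmorphD hornerD. Qed.

Lemma ZadjoinN (a x : algC) : in_Zadjoin a x -> in_Zadjoin a (- x).
Proof. by case=> p ->; exists (- p); rewrite rmorphN hornerN. Qed.

Lemma ZadjoinB (a x y : algC) :
  in_Zadjoin a x -> in_Zadjoin a y -> in_Zadjoin a (x - y).
Proof. by move=> xa ya; apply: ZadjoinD xa (ZadjoinN ya). Qed.

Lemma ZadjoinM (a x y : algC) :
  in_Zadjoin a x -> in_Zadjoin a y -> in_Zadjoin a (x * y).
Proof. by case=> p -> [q ->]; exists (p * q); rewrite rmorphM hornerM. Qed.

Lemma ZadjoinX (a x : algC) k : in_Zadjoin a x -> in_Zadjoin a (x ^+ k).
Proof. by case=> p ->; exists (p ^+ k); rewrite rmorphXn horner_exp. Qed.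

Lemma Zadjoin_sum (a : algC) (I : Type) (r : seq I) (P : pred I) (F : I -> algC) :
  (forall i, P i -> in_Zadjoin a (F i)) -> in_Zadjoin a (\sum_(i <- r | P i) F i).
Proof.
move=> Fa; elim/big_rec: _ => [|i x Pi xa]; first exact: (Zadjoin_nat a 0).
by apply: ZadjoinD xa; apply: Fa.
Qed.

Lemma Zadjoin_horner (a b : algC) (p : {poly int}) :
  in_Zadjoin a b -> in_Zadjoin a (map_poly intr p).[b].
Proof.
move=> ba; rewrite horner_coef; apply: Zadjoin_sum => i _.
by rewrite coef_map; apply: ZadjoinM (ZadjoinX _ ba); apply: Zadjoin_int.
Qed.

Lemma Zadjoin_trans (a b z : algC) :
  in_Zadjoin a b -> in_Zadjoin b z -> in_Zadjoin a z.
Proof. by move=> ba [p ->]; apply: Zadjoin_horner. Qed.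

Lemma Zadjoin_Aint (a z : algC) : a \in Aint -> in_Zadjoin a z -> z \in Aint.
Proof.
move=> aA [p ->]; rewrite horner_coef rpred_sum // => i _.
by rewrite coef_map rpredM ?rpredX //= Aint_int.
Qed.

(** * The Frobenius congruence *)

(** The Frobenius identities are kept as equalities with an explicit multiple
    of p, so that they can be evaluated at algebraic integers, in a ring of
    characteristic 0. *)
Lemma exprD_prime (R : comPzRingType) (p : nat) (x y : R) :
  prime p -> exists c, (x + y) ^+ p = x ^+ p + y ^+ p + p%:R * c.
Proof.
move=> p_pr; have p_gt0 := prime_gt0 p_pr.
(* The two extreme terms of the binomial expansion survive; p divides every
   other binomial coefficient. *)
have [c ->] : exists c, (x + y) ^+ p
    = \sum_(i < p.+1 | (i == ord0) || (i == ord_max)) x ^+ (p - i) * y ^+ i + p%:R * c.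
  exists (\sum_(i < p.+1 | ~~ ((i == ord0) || (i == ord_max)))
            x ^+ (p - i) * y ^+ i *+ ('C(p, i) %/ p)).
  rewrite exprDn (bigID (fun i => (i == ord0) || (i == ord_max))) /=.
  congr (_ + _).
    by apply: eq_bigr => i /orP[] /eqP->; rewrite ?bin0 ?binn.
  rewrite big_distrr /=; apply: eq_bigr => i /norP[i0 ip].
  rewrite mulr_natl -mulrnA divnK // prime_dvd_bin //.
  by move: i0 ip (ltn_ord i); rewrite -!val_eqE /=; lia.
exists c; congr (_ + _).
rewrite (bigD1 ord0) //= (bigD1 ord_max) /=; last first.
  by rewrite -!val_eqE /=; lia.
rewrite big1 => [|i]; last by case/andP=> [/andP[/orP[] ->]].
by rewrite subn0 subnn !expr0 mulr1 mul1r addr0.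
Qed.

Lemma fermat_int (p : nat) (c : int) :
  prime p -> exists d : int, c ^+ p = c + p%:R * d.
Proof.
move=> p_pr; elim/int_rect: c => [|n [d IHn]|n [d IHn]].
- by exists 0; rewrite mulr0 addr0 expr0n; case: p p_pr.
- have [e] := exprD_prime n%:Z 1 p_pr; rewrite IHn expr1n -[n.+1]addn1 PoszD => ->.
  by exists (d + e); ring.
have [e] := exprD_prime (- n.+1%:Z) 1 p_pr.
have -> : - n.+1%:Z + 1 = - n%:Z by lia.
rewrite IHn expr1n => E; exists (d - e); rewrite mulrBr.
have -> : (- n.+1%:Z) ^+ p = - n%:Z + p%:R * d - 1 - p%:R * e by rewrite E; ring.
by rewrite -addn1 PoszD; ring.
Qed.

Lemma frobenius_polyZ (p : nat) (P : {poly int}) : prime p ->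
  exists Q, P ^+ p = P \Po 'X^p + p%:R * Q.
Proof.
move=> p_pr; elim/poly_ind: P => [|P c [Q IHP]].
  by exists 0; rewrite comp_poly0 mulr0 addr0 expr0n; case: p p_pr.
have [d cE] := fermat_int c p_pr.
have [e ->] := exprD_prime (P * 'X) c%:P p_pr.
exists (Q * 'X^p + d%:P + e).
rewrite exprMn IHP -polyC_exp cE comp_polyD comp_polyM comp_polyX comp_polyC.
by rewrite polyCD polyCM polyC_natr; ring.
Qed.

Lemma frobenius_iter_polyZ (p f : nat) (P : {poly int}) : prime p ->
  exists Q, P ^+ (p ^ f) = P \Po 'X^(p ^ f) + p%:R * Q.
Proof.
move=> p_pr; elim: f => [|f [Q IHf]].
  by exists 0; rewrite expn0 expr1 comp_polyXr mulr0 addr0.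
have [Q1 frobE] := frobenius_polyZ (P \Po 'X^(p ^ f)) p_pr.
have [c cE] := exprD_prime (P \Po 'X^(p ^ f)) (p%:R * Q) p_pr.
exists (Q1 + p%:R ^+ p.-1 * Q ^+ p + c).
rewrite expnSr exprM IHf cE frobE -comp_polyA comp_Xn_poly -exprM mulnC.
have -> : (p%:R * Q) ^+ p = p%:R * (p%:R ^+ p.-1 * Q ^+ p).
  by rewrite mulrA -exprS prednK ?prime_gt0 // exprMn.
ring.
Qed.

(** The ring Z[x] / p is reduced when p does not divide the order of x: a
    large power of Frobenius fixes x, hence acts as the identity modulo p.
    The exponent q may be taken as large as desired, which turns weak
    divisibility of a by a prime above p into divisibility by p. *)
Lemma Zadjoin_frobenius_power (p m s : nat) (x a : algC) :
    prime p -> (0 < m)%N -> coprime p m -> x ^+ m = 1 -> in_Zadjoin x a ->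
  exists q b, [/\ (s <= q)%N, in_Zadjoin x b & a ^+ q = a + p%:R * b].
Proof.
move=> p_pr m_gt0 co_pm xm1 [P ->].
(* p ^ f is 1 modulo m by Euler, and at least s. *)
set f := (totient m * s)%N.
have xf : x ^+ (p ^ f) = x.
  have: p ^ f = 1 %[mod m].
    by rewrite /f expnM -modnXm Euler_exp_totient // modnXm exp1n.
  by move=> E; rewrite -(expr_mod _ xm1) E (expr_mod _ xm1).
have [Q QE] := frobenius_iter_polyZ f P p_pr.
exists (p ^ f)%N, (map_poly intr Q).[x]; split.
- rewrite (leq_trans (_ : s <= f)%N) ?leq_pmull ?totient_gt0 //.
  exact/ltnW/ltn_expl/prime_gt1.
- by exists Q.
rewrite -horner_exp -rmorphXn QE rmorphD rmorphM /= rmorph_nat hornerD hornerM.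
by rewrite map_comp_poly map_polyXn horner_comp hornerXn xf -polyC_natr hornerC.
Qed.

(** * Maximality of Z[x] at a prime not dividing the order of x *)

Lemma Aint_monic_root (z : algC) : z \in Aint ->
  exists2 q : {poly int}, q \is monic & root (map_poly intr q) z.
Proof.
move=> zA; have [q qE] : {q : {poly int} | minCpoly z = map_poly intr q}.
  by apply: floorpP; rewrite -[_ \is a _]/(z \in Aint).
exists q; last by rewrite -qE root_minCpoly.
apply/eqP/(@intr_inj algC).
rewrite -(lead_coef_map_inj (@intr_inj algC) (mulr0z 1)) -qE.
exact/monicP/minCpoly_monic.
Qed.

Lemma Aint_monic_eq (z : algC) : z \in Aint ->
  exists d (c : nat -> int), z ^+ d = \sum_(i < d) (c i)%:~R * z ^+ i.
Proof.
move=> /Aint_monic_root[q q_mon /rootP].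
rewrite horner_coef (size_map_inj_poly (@intr_inj algC) (mulr0z 1)).
have q_gt0 : (0 < size q)%N by rewrite size_poly_gt0 monic_neq0.
rewrite -(prednK q_gt0) big_ord_recr /= coef_map /=.
rewrite -[q`_(_).-1]/(lead_coef q) (monicP q_mon) mul1r addrC.
move=> /eqP; rewrite addr_eq0 => /eqP zE.
exists (size q).-1, (fun i => - q`_i); rewrite zE -sumrN.
by apply: eq_bigr => i _; rewrite coef_map rmorphN mulNr.
Qed.

(** An integral equation of degree d for z expresses every power of z through
    the first d ones, so that p ^ d is a common denominator for all of them. *)
Lemma Aint_bounded_denominator (x z : algC) (p : nat) :
    z \in Aint -> in_Zadjoin x (p%:R * z) ->
  exists d, forall k, in_Zadjoin x (p%:R ^+ d * z ^+ k).
Proof.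
move=> zA pzx; have [d [c zd]] := Aint_monic_eq zA; exists d.
elim/ltn_ind=> k IHk; have [k_le_d | /ltnW d_le_k] := leqP k d.
  rewrite -(subnK k_le_d) exprD -mulrA -exprMn.
  by apply: ZadjoinM (ZadjoinX _ pzx); apply/ZadjoinX/Zadjoin_nat.
have [d_eq0 | d_gt0] := posnP d.
  move: zd; rewrite d_eq0 big_ord0 expr0 => /eqP.
  by rewrite oner_eq0.
rewrite -(subnK d_le_k) [z ^+ _]exprD zd 2!big_distrr /=.
apply: Zadjoin_sum => i _.
have -> : p%:R ^+ d * (z ^+ (k - d) * ((c i)%:~R * z ^+ i))
        = (c i)%:~R * (p%:R ^+ d * z ^+ (k - d + i)) by rewrite exprD; ring.
by apply: ZadjoinM (Zadjoin_int _ _) (IHk _ _); have := ltn_ord i; lia.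
Qed.

(** Put a = p z. On the one hand a large power a ^ q = p ^ q z ^ q lies in
    p Z[x], because powers of z have a bounded denominator; on the other hand
    a ^ q is a modulo p Z[x], by Frobenius. Hence a is in p Z[x]. *)
Lemma Zadjoin_maximal_unramified (p m : nat) (x z : algC) :
    prime p -> (0 < m)%N -> coprime p m -> x ^+ m = 1 ->
  z \in Aint -> in_Zadjoin x (p%:R * z) -> in_Zadjoin x z.
Proof.
move=> p_pr m_gt0 co_pm xm1 zA pzx.
have [d dP] := Aint_bounded_denominator zA pzx.
have [q [b [d_lt_q bx qE]]] := Zadjoin_frobenius_power d.+1 p_pr m_gt0 co_pm xm1 pzx.
have p_neq0 : p%:R != 0 :> algC by rewrite pnatr_eq0 -lt0n prime_gt0.
have -> : z = p%:R ^+ (q - d.+1) * (p%:R ^+ d * z ^+ q) - b.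
  have powE : p%:R * (p%:R ^+ (q - d.+1) * (p%:R ^+ d * z ^+ q)) = (p%:R * z) ^+ q.
    by rewrite exprMn !mulrA -exprS -exprD; congr (_ ^+ _ * _); lia.
  by apply: (mulfI p_neq0); rewrite mulrBr powE qE addrK.
apply: ZadjoinB bx; apply: ZadjoinM (dP q).
exact/ZadjoinX/Zadjoin_nat.
Qed.

(** * The prime above p in the p-power cyclotomic ring *)

(** The product formula for cyclotomic polynomials gives
    'Phi_(p ^ k.+1) = 1 + Y + ... + Y ^ (p - 1) with Y = 'X^(p ^ k). *)
Lemma Cyclotomic_pfactor_at1 (p k : nat) : prime p -> ('Phi_(p ^ k.+1)).[1] = p%:R.
Proof.
move=> p_pr; have p_gt0 k' : (0 < p ^ k')%N by rewrite expn_gt0 prime_gt0.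
have pk_perm : perm_eq (divisors (p ^ k.+1)) (p ^ k.+1 :: divisors (p ^ k))%N.
  apply: uniq_perm; rewrite /= ?divisors_uniq // ?andbT.
    by rewrite -dvdn_divisors // dvdn_Pexp2l ?prime_gt1 // ltnn.
  move=> d; rewrite inE -!dvdn_divisors //.
  apply/idP/orP=> [/(dvdn_pfactor _ _ p_pr)[j] | [/eqP-> // | d_dv]].
    rewrite leq_eqVlt => /predU1P[-> -> | j_lt ->]; [by left | right].
    by rewrite dvdn_exp2l.
  by rewrite (dvdn_trans d_dv) // dvdn_exp2l.
have := prod_Cyclotomic (p_gt0 k.+1).
rewrite (perm_big _ pk_perm) big_cons prod_Cyclotomic // expnSr exprM.
rewrite [RHS]subrX1 [LHS]mulrC.
move/mulfI => -> //; last first.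
  by rewrite -size_poly_eq0 size_XnsubC ?(p_gt0 k).
rewrite horner_sum (eq_bigr (fun=> 1)) => [|i _]; last first.
  by rewrite -exprM hornerXn expr1n.
by rewrite sumr_const card_ord.
Qed.

Lemma prod_one_sub_prim_root (p k : nat) (h : algC) : prime p ->
    (p ^ k.+1).-primitive_root h ->
  \prod_(j < p ^ k.+1 | coprime j (p ^ k.+1)) (1 - h ^+ j) = p%:R.
Proof.
move=> p_pr h_prim.
have := congr1 (fun P => P.[1]) (Cintr_Cyclotomic h_prim).
rewrite -[1 in LHS](rmorph1 intr) horner_map Cyclotomic_pfactor_at1 // rmorph_nat => ->.
by rewrite /cyclotomic horner_prod; apply: eq_bigr => j _; rewrite hornerXsubC.
Qed.

(** The prime p is totally ramified in Z[h], with uniformizer 1 - h: p is the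
    product of the 1 - h ^ j for j coprime to p, and each of them is associated
    to 1 - h since h and h ^ j are powers of each other. *)
Lemma prime_eq_unit_mul_uniformizer (p k : nat) (h : algC) : prime p ->
    (p ^ k.+1).-primitive_root h ->
  exists e u v, [/\ in_Zadjoin h u, in_Zadjoin h v,
    p%:R = u * (1 - h) ^+ e.+1 & (1 - h) ^+ e.+1 = v * p%:R].
Proof.
move=> p_pr h_prim; set n := (p ^ k.+1)%N in h_prim *.
have hn1 : h ^+ n = 1 := prim_expr_order h_prim.
have n_gt1 : (1 < n)%N by rewrite -(exp1n k.+1) ltn_exp2r ?prime_gt1.
(* g j is (1 - h ^ j) / (1 - h); g' j is its inverse, since h is the power of
   h ^ j of exponent j ^ (totient n - 1). *)
pose g (j : nat) : algC := \sum_(i < j) h ^+ i.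
pose g' (j : nat) : algC := \sum_(i < j ^ (totient n).-1) (h ^+ j) ^+ i.
have gE j : 1 - h ^+ j = g j * (1 - h).
  by rewrite -[LHS]opprB subrX1 -mulNr opprB mulrC.
have g'E j : coprime j n -> 1 - h = g' j * (1 - h ^+ j).
  move=> co_jn; rewrite mulrC -[1 - h ^+ j]opprB mulNr -subrX1 opprB -exprM -expnS.
  rewrite prednK ?totient_gt0 ?(ltnW n_gt1) //.
  by rewrite -(expr_mod _ hn1) Euler_exp_totient // modn_small // expr1.
pose e := #|[pred j : 'I_n | coprime j n]|.
have e_gt0 : (0 < e)%N.
  by apply/card_gt0P; exists (Ordinal n_gt1); rewrite inE /= coprime1n.
exists e.-1, (\prod_(j < n | coprime j n) g j), (\prod_(j < n | coprime j n) g' j).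
have prodA (F : nat -> algC) : (forall j, in_Zadjoin h (F j)) ->
    in_Zadjoin h (\prod_(j < n | coprime j n) F j).
  by move=> Fh; elim/big_rec: _ => [|j y _]; [exact: Zadjoin1 | apply/ZadjoinM/Fh].
rewrite prednK //; split.
- by apply: prodA => j; apply: Zadjoin_sum => i _; apply/ZadjoinX/Zadjoin_gen.
- apply: prodA => j; apply: Zadjoin_sum => i _.
  by do 2!apply: ZadjoinX; apply: Zadjoin_gen.
- rewrite -prodr_const -big_split /= -(prod_one_sub_prim_root p_pr h_prim).
  by apply: eq_bigr => j _; rewrite gE.
rewrite -prodr_const -(prod_one_sub_prim_root p_pr h_prim) -big_split /=.
by apply: eq_bigr => j; apply: g'E.
Qed.

(** * The ring of integers of a cyclotomic field *)

Lemma Zadjoin_horner_congr (x a b c : algC) (P : {poly int}) :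
    in_Zadjoin x a -> in_Zadjoin x b -> in_Zadjoin x c ->
  exists2 d, in_Zadjoin x d
    & (map_poly intr P).[a + c * b] = (map_poly intr P).[a] + c * d.
Proof.
move=> ax bx cx; elim/poly_ind: P => [|P r [d dx IHP]].
  by exists 0; [exact: (Zadjoin_nat x 0) | rewrite rmorph0 !horner0 mulr0 addr0].
exists (d * (a + c * b) + (map_poly intr P).[a] * b).
  apply: ZadjoinD; apply: ZadjoinM => //; last exact: Zadjoin_horner.
  by apply: ZadjoinD ax _; apply: ZadjoinM.
rewrite rmorphD rmorphM /= map_polyX map_polyC /= !(hornerE, hornerMX) IHP; ring.
Qed.

(** Here pi has a power divisible by p. If pi divides a in the algebraic
    integers, then p divides large powers of a, hence a itself by Frobenius,
    and the quotient is in Z[x] because Z[x] is maximal at p. *)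
Lemma uniformizer_dvd_tame (p m e : nat) (x pi v a c : algC) :
    prime p -> (0 < m)%N -> coprime p m -> x ^+ m = 1 ->
    pi \in Aint -> v \in Aint -> pi ^+ e = v * p%:R ->
    in_Zadjoin x a -> c \in Aint -> a = pi * c ->
  exists2 w, in_Zadjoin x w & a = p%:R * w.
Proof.
move=> p_pr m_gt0 co_pm xm1 piA vA pi_e ax cA aE.
have [q [b [e_le_q bx aqE]]] := Zadjoin_frobenius_power e p_pr m_gt0 co_pm xm1 ax.
have xA : x \in Aint by apply: (Aint_unity_root m_gt0); apply/unity_rootP.
pose w := v * pi ^+ (q - e) * c ^+ q - b.
have aw : a = p%:R * w.
  have -> : a = a ^+ q - p%:R * b by rewrite aqE addrK.
  by rewrite {1}aE exprMn -{1}(subnK e_le_q) exprD pi_e /w; ring.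
exists w => //; apply: (Zadjoin_maximal_unramified p_pr m_gt0 co_pm xm1).
  by rewrite rpredB ?rpredM ?rpredX ?(Zadjoin_Aint xA bx).
by rewrite -aw.
Qed.

(** Write N = m p ^ k with p not dividing m. If k > 0, let h = y ^ m, of order
    p ^ k, and let x be a power of y which has order prime to p and is congruent
    to y modulo pi = 1 - h. Thus every element of Z[y] is congruent modulo
    pi Z[y] to an element of Z[x]. With p = u pi ^ e, where u is a unit, the
    element p z lies in pi ^ i Z[y] + p Z[y] for i = 0, and this improves one
    exponent at a time up to i = e: if p z = pi ^ i a + p b with i < e, then pi
    divides a, hence also the element of Z[x] to which a is congruent, and that
    element is then in p Z[x]. For i = e the sum is p Z[y], so z is in Z[y]. *)
Lemma Zadjoin_maximal (p N : nat) (y z : algC) :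
    prime p -> N.-primitive_root y -> z \in Aint -> in_Zadjoin y (p%:R * z) ->
  in_Zadjoin y z.
Proof.
move=> p_pr y_prim zA pzy; have N_gt0 := prim_order_gt0 y_prim.
have yA := Aint_prim_root y_prim; have yN1 := prim_expr_order y_prim.
have [m co_pm NE] := pfactor_coprime p_pr N_gt0.
have m_gt0 : (0 < m)%N by move: N_gt0; rewrite NE muln_gt0 => /andP[].
case k_eq: (logn p N) NE => [|k] NE.
  rewrite muln1 in NE; rewrite NE in yN1.
  exact: Zadjoin_maximal_unramified p_pr m_gt0 co_pm yN1 zA pzy.
(* The exponent s is a multiple of the order of h and is 1 modulo m. *)
pose h := y ^+ m; pose s := ((p ^ k.+1) ^ totient m)%N; pose x := y ^+ s.
have yy := Zadjoin_gen y; have hy : in_Zadjoin y h by apply: ZadjoinX.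
have xy : in_Zadjoin y x by apply: ZadjoinX.
have h_prim : (p ^ k.+1).-primitive_root h.
  have := dvdn_prim_root y_prim (_ : p ^ k.+1 %| N)%N.
  by rewrite NE dvdn_mull // mulnK ?expn_gt0 ?prime_gt0 //; apply.
have xm1 : x ^+ m = 1.
  rewrite /x -exprM; apply/eqP; rewrite -(prim_order_dvd y_prim) NE [(s * m)%N]mulnC.
  by rewrite dvdn_mul // dvdn_exp ?totient_gt0.
have [t sE] : exists t, s = (1 + m * t)%N.
  have s_mod : s = 1 %[mod m] by rewrite Euler_exp_totient // coprimeXl.
  have s_gt0 : (0 < s)%N by rewrite !expn_gt0 prime_gt0.
  exists ((s - 1) %/ m)%N; rewrite [(m * _)%N]mulnC divnK ?subnKC //.
  by rewrite -eqn_mod_dvd //; apply/eqP.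
have [e [u [v [uh vh pE piE]]]] := prime_eq_unit_mul_uniformizer p_pr h_prim.
set pi := 1 - h in pE piE.
have piy : in_Zadjoin y pi by apply: ZadjoinB hy; apply: Zadjoin1.
have piA := Zadjoin_Aint yA piy.
have uA := Zadjoin_Aint yA (Zadjoin_trans hy uh).
have vA := Zadjoin_Aint yA (Zadjoin_trans hy vh).
have p_neq0 : p%:R != 0 :> algC by rewrite pnatr_eq0 -lt0n prime_gt0.
have pi_neq0 : pi != 0.
  by apply: contra_neq p_neq0 => pi0; rewrite pE pi0 exprS mul0r mulr0.
have [b0 b0y yE] : exists2 b0, in_Zadjoin y b0 & y = x + pi * b0.
  exists (y * \sum_(i < t) h ^+ i).
    by apply: ZadjoinM => //; apply: Zadjoin_sum => i _; apply: ZadjoinX.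
  rewrite /x sE exprD expr1 exprM -/h mulrCA.
  have -> : pi * \sum_(i < t) h ^+ i = 1 - h ^+ t.
    by rewrite -[RHS]opprB subrX1 -mulNr opprB.
  ring.
suff approx i : (i <= e.+1)%N -> exists a b,
    [/\ in_Zadjoin y a, in_Zadjoin y b & p%:R * z = pi ^+ i * a + p%:R * b].
  have [a [b [ay yb pzE]]] := approx e.+1 (leqnn _).
  have -> : z = v * a + b by apply: (mulfI p_neq0); rewrite pzE piE; ring.
  by apply: ZadjoinD yb; apply: ZadjoinM ay; apply: Zadjoin_trans vh.
elim: i => [|i IHi] i_le_e.
  exists (p%:R * z), 0; split=> //; first exact: (Zadjoin_nat y 0).
  by rewrite expr0; ring.
have [a [b [ay yb pzE]]] := IHi (ltnW i_le_e).
have bA := Zadjoin_Aint yA yb.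
have aE : a = pi * (u * pi ^+ (e - i) * (z - b)).
  apply: (mulfI (expf_neq0 i pi_neq0)).
  have -> : pi ^+ i * a = p%:R * (z - b) by rewrite mulrBr pzE; ring.
  rewrite pE -[in LHS](subnKC i_le_e) exprD exprS subSS; ring.
have [P aP] := ay.
have [d dy PyE] := Zadjoin_horner_congr P xy b0y piy.
have a0x : in_Zadjoin x (map_poly intr P).[x] by exists P.
have dA := Zadjoin_Aint yA dy.
have [w wx wE] : exists2 w, in_Zadjoin x w & (map_poly intr P).[x] = p%:R * w.
  apply: (uniformizer_dvd_tame p_pr m_gt0 co_pm xm1 piA vA piE a0x
            (c := u * pi ^+ (e - i) * (z - b) - d)).
    by rewrite !(rpredB, rpredM, rpredX).
  by rewrite mulrBr -aE aP {1}yE PyE addrK.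
exists d, (b + pi ^+ i * w); split=> //.
  by apply: ZadjoinD yb _; apply: ZadjoinM (ZadjoinX _ piy) (Zadjoin_trans xy wx).
by rewrite pzE aP {1}yE PyE wE exprSr; ring.
Qed.

(** A denominator of z is removed one prime factor at a time, so that
    maximality at every prime makes Z[y] the full ring of integers. *)
Lemma cyclotomic_integers (N D : nat) (y z : algC) :
    N.-primitive_root y -> (0 < D)%N -> z \in Aint -> in_Zadjoin y (D%:R * z) ->
  in_Zadjoin y z.
Proof.
move=> y_prim; elim/ltn_ind: D z => D IHD z D_gt0 zA Dzy.
have [D_le1 | D_gt1] := leqP D 1.
  by move: Dzy; rewrite (_ : D = 1%N) ?mul1r //; lia.
have p_pr := pdiv_prime D_gt1; have DE := divnK (pdiv_dvd D).
set D' := (D %/ pdiv D)%N in DE.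
have D'_gt0 : (0 < D')%N by move: D_gt0; rewrite -DE muln_gt0 => /andP[].
apply: (IHD D') => //; first by rewrite -DE ltn_Pmulr ?prime_gt1.
apply: (Zadjoin_maximal p_pr y_prim).
  by rewrite rpredM // Aint_Cnat ?rpred_nat.
by rewrite mulrA -natrM mulnC DE.
Qed.

(** * Denominators in Q(a) *)

(** After removal of the factors 'X from a monic integer equation of b, the
    constant term is a nonzero multiple of b. *)
Lemma Aint_dvd_int (b : algC) : b \in Aint -> b != 0 ->
  exists2 s, in_Zadjoin b s & exists2 c : int, c != 0 & s * b = c%:~R.
Proof.
move=> /Aint_monic_root[q q_mon qb0] b_neq0.
have [k [r]] := multiplicity_XsubC q 0; rewrite monic_neq0 //= subr0 => r0 qE.
have rb0 : (map_poly intr r).[b] = 0.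
  apply/eqP; move: qb0; rewrite qE rmorphM /= map_polyXn rootM.
  by rewrite [root 'X^k b]rootE hornerXn expf_eq0 (negPf b_neq0) andbF orbF.
have [t rE] : exists t, r - (r.[0])%:P = t * ('X - 0%:P).
  by apply/factor_theorem; rewrite rootE !hornerE subrr.
exists (map_poly intr t).[b]; first by exists t.
exists (- r.[0]); first by rewrite oppr_eq0.
have := congr1 (fun P => (map_poly intr P).[b]) rE.
rewrite /= subr0 rmorphB rmorphM /= map_polyX map_polyC hornerMX => <-.
by rewrite hornerD hornerN hornerC rb0 add0r rmorphN.
Qed.

Lemma horner_ratr_denominator (a : algC) (P : {poly rat}) :
  exists2 c : int, c != 0 & in_Zadjoin a (c%:~R * (map_poly ratr P).[a]).
Proof.
have [q [c c_neq0 ->]] := rat_poly_scale P; exists c => //; exists q.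
rewrite map_polyZ hornerZ /= fmorphV /= ratr_int mulrA divff ?intr_eq0 // mul1r.
rewrite -map_poly_comp; congr (_.[a]); apply: eq_map_poly => i /=.
by rewrite ratr_int.
Qed.

Lemma Qadjoin_denominator (a z : algC) : a \in Aint -> in_Qadjoin a z ->
  exists2 D, (0 < D)%N & in_Zadjoin a (D%:R * z).
Proof.
move=> aA [P [Q [Qa_neq0 ->]]]; set b := _.[a] in Qa_neq0 *; set d := _.[a].
have [c1 c1_neq0 da] := horner_ratr_denominator a P; rewrite -/d in da.
have [c2 c2_neq0 ba] := horner_ratr_denominator a Q; rewrite -/b in ba.
have bA := Zadjoin_Aint aA ba.
have b'_neq0 : c2%:~R * b != 0 by rewrite mulf_neq0 ?intr_eq0.
have [s sb [c c_neq0 cE]] := Aint_dvd_int bA b'_neq0.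
pose e := c * c1; exists `|e|%N; first by rewrite absz_gt0 mulf_neq0.
have -> : `|e|%N%:R * (d / b) = (sgz e * c2)%:~R * (c1%:~R * d) * s.
  have -> : `|e|%N%:R = (sgz e * e)%:~R :> algC by rewrite -abszEsg.
  by rewrite !rmorphM /= -cE; field.
apply: ZadjoinM (Zadjoin_trans ba sb).
exact: ZadjoinM (Zadjoin_int _ _) da.
Qed.

(** * The ring of integers of Q(y - 1/y) *)

Lemma Zadjoin_quadratic_basis (y a w : algC) :
    y ^+ 2 = a * y + 1 -> in_Zadjoin y w ->
  exists w1 w2, [/\ in_Zadjoin a w1, in_Zadjoin a w2 & w = w1 + w2 * y].
Proof.
move=> y2 [P ->]; elim/poly_ind: P => [|P c [w1 [w2 [w1a w2a IHP]]]].
  by exists 0, 0; split; [exact: (Zadjoin_nat a 0).. | rewrite rmorph0 horner0; ring].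
exists (w2 + c%:~R), (w1 + w2 * a); split.
- exact: ZadjoinD w2a (Zadjoin_int _ _).
- exact: ZadjoinD w1a (ZadjoinM w2a (Zadjoin_gen a)).
rewrite rmorphD rmorphM /= map_polyX map_polyC /= hornerD hornerMX hornerC IHP.
have -> : (w1 + w2 * y) * y = w1 * y + w2 * y ^+ 2 by ring.
by rewrite y2; ring.
Qed.

Lemma rmorph_Zadjoin_fixed (u : {rmorphism algC -> algC}) (a z : algC) :
  u a = a -> in_Zadjoin a z -> u z = z.
Proof.
move=> ua [P ->]; rewrite -horner_map /= ua -map_poly_comp.
by congr (_.[a]); apply: eq_map_poly => c /=; rewrite rmorph_int.
Qed.

Lemma prim_root_half (N : nat) (y : algC) :
  N.-primitive_root y -> (2 %| N)%N -> y ^+ (N %/ 2) = -1.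
Proof.
move=> y_prim N_even; have N_gt0 := prim_order_gt0 y_prim.
have: (y ^+ (N %/ 2)) ^+ 2 == 1 by rewrite -exprM divnK // (prim_expr_order y_prim).
rewrite sqrf_eq1 => /orP[|/eqP //].
rewrite -(prim_order_dvd y_prim) => /dvdn_leq; lia.
Qed.

(** An integer z of Q(a), for a = y - 1/y, lies in the cyclotomic ring Z[y],
    that is, z = w1 + w2 y with w1 and w2 in Z[a]. As 4 divides N, the
    exponent N / 2 - 1 is coprime to N and some automorphism maps y to
    y ^ (N / 2 - 1) = - 1/y. It fixes a, hence z, w1 and w2, so that
    w2 (y + 1/y) = 0, and y + 1/y is nonzero because y does not have
    order 4. *)
Lemma sub_inv_integers (N : nat) (y z : algC) :
    N.-primitive_root y -> (4 %| N)%N -> (N != 4)%N ->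
    in_Qadjoin (y - y^-1) z -> z \in Aint ->
  in_Zadjoin (y - y^-1) z.
Proof.
move=> y_prim N4 N_neq4; set a := y - y^-1 => zQ zA.
have N_gt0 := prim_order_gt0 y_prim.
have y_neq0 : y != 0.
  apply: contra_eq_neq (prim_expr_order y_prim) => ->.
  by rewrite expr0n -(prednK N_gt0) eq_sym oner_eq0.
have yA := Aint_prim_root y_prim.
have yVE : y^-1 = y ^+ N.-1.
  by apply: (mulfI y_neq0); rewrite mulfV // -exprS prednK // (prim_expr_order y_prim).
have ay : in_Zadjoin y a.
  by apply: ZadjoinB; rewrite ?yVE; [|apply: ZadjoinX]; apply: Zadjoin_gen.
have [D D_gt0 Dza] := Qadjoin_denominator (Zadjoin_Aint yA ay) zQ.
have zy := cyclotomic_integers y_prim D_gt0 zA (Zadjoin_trans ay Dza).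
have y2 : y ^+ 2 = a * y + 1 by rewrite /a; field.
have [w1 [w2 [w1a w2a zE]]] := Zadjoin_quadratic_basis y2 zy.
have co_N : coprime (N %/ 2).-1 N.
  (* With K = N / 2 - 1 = 2 j + 1, N is 2 K + 2 and gcd (K, N) = gcd (K, 2). *)
  have [j ->] : exists j, N = (4 * j.+1)%N.
    by exists (N %/ 4).-1; rewrite prednK ?divn_gt0 ?(dvdn_leq N_gt0) // mulnC divnK.
  have -> : ((4 * j.+1) %/ 2).-1 = (2 * j).+1 by lia.
  have -> : (4 * j.+1 = 2 * (2 * j).+1 + 2)%N by lia.
  by rewrite /coprime gcdnMDl -[_ == _]/(coprime _ 2) coprimen2 /= mul2n odd_double.
have [u uE] := Qn_aut_exists co_N.
have uy : u y = - y^-1.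
  rewrite uE ?(prim_expr_order y_prim) //; apply: (mulfI y_neq0).
  rewrite -exprS prednK; last by lia.
  by rewrite mulrN mulfV // prim_root_half // (dvdn_trans _ N4).
have ua : u a = a by rewrite /a rmorphB fmorphV uy invrN invrK opprK addrC.
have uz : u z = z.
  have D_neq0 : D%:R != 0 :> algC by rewrite pnatr_eq0 -lt0n.
  apply: (mulfI D_neq0); have := rmorph_Zadjoin_fixed ua Dza.
  by rewrite rmorphM rmorph_nat.
have: w2 * (y + y^-1) = 0.
  have: u z = w1 - w2 * y^-1.
    rewrite zE rmorphD rmorphM (rmorph_Zadjoin_fixed ua w1a).
    by rewrite (rmorph_Zadjoin_fixed ua w2a) uy mulrN.
  rewrite uz zE => /addrI E; rewrite mulrDr E; ring.
move/eqP; rewrite mulf_eq0 => /orP[/eqP w2_0 | /eqP y_sum].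
  by rewrite zE w2_0 mul0r addr0.
have: y ^+ 4 == 1.
  have y2N : y ^+ 2 = -1.
    have -> : y ^+ 2 = (y + y^-1) * y - 1 by field.
    by rewrite y_sum mul0r sub0r.
  by rewrite (exprM y 2 2) y2N sqrrN expr1n.
rewrite -(prim_order_dvd y_prim) => N_dv4.
by move: N_neq4; rewrite eqn_dvd N4 N_dv4.
Qed.

(** * Lucas polynomials *)

Lemma lucasSS (n : nat) : lucas n.+2 = 'X * lucas n.+1 + lucas n.
Proof. by []. Qed.

Lemma lucas_eval (y : algC) (n : nat) : y != 0 ->
  (map_poly intr (lucas n)).[y - y^-1] = y ^+ n + (- y^-1) ^+ n.
Proof.
move=> y_neq0; elim/ltn_ind: n => -[|[|n]] IHn.
- by rewrite /= rmorph_nat -polyC_natr hornerC; ring.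
- by rewrite /= map_polyX hornerX.
move: (IHn n.+1 (ltnSn _)) (IHn n (ltnW (ltnSn _))).
rewrite lucasSS; move: (lucas n.+1) (lucas n) => P Q PE QE.
by rewrite rmorphD rmorphM /= map_polyX hornerD hornerM hornerX PE QE !exprS; field.
Qed.

Lemma lucas_monic (n : nat) : lucas n.+1 \is monic.
Proof.
suff: (size (lucas n.+1) = n.+2) /\ lucas n.+1 \is monic by case.
elim/ltn_ind: n => -[|n] IHn; first by rewrite size_polyX monicX.
rewrite lucasSS.
have [sz1 mon1] := IHn n (ltnSn n).
have szX : size ('X * lucas n.+1) = n.+3.
  by rewrite mulrC size_mulX ?sz1 ?monic_neq0.
have sz_lt : (size (lucas n) < size ('X * lucas n.+1)%R)%N.
  rewrite szX; case: n IHn {sz1 mon1 szX} => [_|n IHn].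
    by rewrite /= -polyC_natr size_polyC.
  by have [-> _] := IHn n (leqW (ltnSn n)).
by rewrite size_polyDl // monicE lead_coefDl // -monicE monicMl ?monicX.
Qed.

(** A constant factor of a monic polynomial is a unit, so that a nonunit factor
    is not constant. *)
Lemma nonunit_monic_dvd_root (f g : {poly int}) :
  f \isn't a GRing.unit -> g * f \is monic -> exists a : algC, root (map_poly intr f) a.
Proof.
move=> f_nonunit /monicP; rewrite lead_coefM => lead_gf.
apply/closed_rootP; rewrite (size_map_inj_poly (@intr_inj algC) (mulr0z 1)).
apply: contraNneq f_nonunit => sz1; rewrite poly_unitE sz1 eqxx /=.
have -> : f`_0 = lead_coef f by rewrite lead_coefE sz1.
by apply/unitrPr; exists (lead_coef g); rewrite mulrC.
Qed.

Theorem theorem1p2 (n : nat) (n_gt0 : (0 < n)%N) (n_even : ~~ odd n)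
    (f : {poly int}) (f_irr : irreducibleZ f)
    (f_dvd : exists g : {poly int}, lucas n = g * f) :
  monogenic f.
Proof.
split=> //; have [g lucasE] := f_dvd; have [_ f_nonunit _] := f_irr.
have [a fa] : exists a : algC, root (map_poly intr f) a.
  apply: (nonunit_monic_dvd_root f_nonunit (g := g)).
  by rewrite -lucasE -(prednK n_gt0) lucas_monic.
have [y y2] : exists y : algC, y ^+ 2 = a * y + 1.
  have [y] := @solve_monicpoly algC 2%N (fun i => if i is 0%N then 1 else a) isT.
  by rewrite !big_ord_recr big_ord0 /= => yE; exists y; rewrite yE; ring.
have y_neq0 : y != 0.
  by apply: contra_eq_neq y2 => ->; rewrite mulr0 add0r expr0n eq_sym oner_eq0.
have aE : a = y - y^-1.
  by apply: (mulIf y_neq0); rewrite mulrBl mulVf // -expr2 y2 addrK.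
have y2n : y ^+ (2 * n) = -1.
  have: (map_poly intr (lucas n)).[a] = 0.
    by rewrite lucasE rmorphM hornerM (rootP fa) mulr0.
  rewrite aE lucas_eval // exprNn -signr_odd (negPf n_even) expr0 mul1r exprVn => E.
  have -> : y ^+ (2 * n) = (y ^+ n + (y ^+ n)^-1) * y ^+ n - 1.
    by rewrite mulrDl mulVf ?expf_neq0 // addrK mulnC exprM expr2.
  by rewrite E mul0r sub0r.
have y4n : y ^+ (2 * n * 2) = 1 by rewrite exprM y2n sqrrN expr1n.
have n4_gt0 : (0 < 2 * n * 2)%N by rewrite !muln_gt0 n_gt0.
have [N y_prim N_dvd] := prim_order_exists n4_gt0 y4n.
have N_gt0 := prim_order_gt0 y_prim.
have N_ndvd : ~~ (N %| 2 * n)%N.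
  by rewrite (prim_order_dvd y_prim) y2n eqNr oner_eq0.
(* The cofactor r in 4 n = r N is odd and 8 divides 4 n. *)
have N8 : (8 %| N)%N.
  have [r rE] := dvdnP N_dvd.
  have r_odd : odd r.
    apply: contraR N_ndvd => r_even; apply/dvdnP; exists r./2.
    by apply/eqP; rewrite -(eqn_pmul2r (isT : 0 < 2)%N) rE mulnAC muln2 even_halfK.
  have co_8r : coprime 8 r by rewrite (coprimeXl 3 (_ : coprime 2 r)) ?coprime2n.
  rewrite -(Gauss_dvdr _ co_8r).
  by rewrite -rE -(even_halfK n_even) -muln2 mulnCA -mulnA dvdn_mull.
have aA : a \in Aint.
  rewrite aE rpredB ?(Aint_prim_root y_prim) //; apply: (Aint_unity_root N_gt0).
  by apply/unity_rootP; rewrite exprVn (prim_expr_order y_prim) invr1.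
exists a => // z; split=> [za | [zQ zA]].
  split; last exact: Zadjoin_Aint za.
  have [P ->] := za; exists (map_poly intr P), 1; split.
    by rewrite rmorph1 hornerC oner_neq0.
  rewrite rmorph1 hornerC divr1 -map_poly_comp.
  by congr (_.[a]); apply: eq_map_poly => c /=; rewrite ratr_int.
rewrite aE in zQ *; apply: (sub_inv_integers y_prim) => //.
  exact: dvdn_trans N8.
by apply: contraL N8 => /eqP->.
Qed.
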